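(* Let $k$ be a field and let $H$ be a numerical semigroup with embedding dimension $n\ge3$ and multiplicity $a$. Suppose that $k[H]/(t^{a})$ is stretched, that $\mathrm{PF}(H)=\{h+\alpha,h+2\alpha,\ldots,h+(n-1)\alpha\}$ for some integers $h\ge0$ and $\alpha>0$, and that $\ell:=a-n+1\ge2$. Suppose further that, with $j=1$, the set $$\left\{a,\ \tfrac{h+j\alpha+a}{\ell}\right\}\cup\bigl(\{h+i\alpha+a\mid 1\le i\le n-1\}\setminus\{h+j\alpha+a\}\bigr)$$ is the minimal system of generators of $H$. Put $b=\frac{h+\alpha+a}{\ell}$, and let $h_1\ge 0$ be the integer with $h=h_1a+(\ell-1)b$ (such an integer exists in this situation). Let $\mathfrak{m}$ be the graded maximal ideal of $k[H]$ and $\mathrm{gr}(k[H])=\bigoplus_{i\ge0}\mathfrak{m}^i/\mathfrak{m}^{i+1}$. Then $\mathrm{gr}(k[H])$ is Cohen–Macaulay if and only if $h_1+1\ge\ell$.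
   Context: A numerical semigroup is a submonoid $H$ of $\mathbb{Z}_{\ge0}$ generated by finitely many positive integers with gcd $1$; its embedding dimension is the size of its minimal system of generators and its multiplicity is $\min(H\setminus\{0\})$. $k[H]\subseteq k[t]$ is the $k$-subalgebra generated by $t^s$, $s\in H$; its graded maximal ideal is $(t^s\mid 0<s\in H)$. $\mathrm{PF}(H)=\{\alpha\in\mathbb{Z}\setminus H\mid \alpha+s\in H\text{ for all }0<s\in H\}$. An Artinian local ring with maximal ideal $\mathfrak{n}$ is called stretched if $\mathfrak{n}^2=(0)$ or $\mathfrak{n}^2$ is principal. *)

(* Defs.v *)
From HB Require Import structures.
From mathcomp Require Import all_boot all_order all_algebra.
From mathcomp Require Import mathcomp_extra boolp classical_sets functions.
From mathcomp Require Import cardinality.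

Set Implicit Arguments.
Unset Strict Implicit.
Unset Printing Implicit Defensive.

Import GRing.Theory.
Local Open Scope ring_scope.
Local Open Scope classical_set_scope.

(* Rings below may be zero ([comPzRingType]) and ideals need not be proper,   *)
(* unlike [idealr] of ring_quotient, so that quotients by arbitrary generated *)
(* ideals can be formed without side conditions.                              *)

Identity Coercion set_Funclass : set >-> Funclass.

Section Ideals.
Variable A : comPzRingType.
Implicit Types (S I : set A).

Definition ideal_closed S : Prop :=
  [/\ S 0, (forall x y, S x -> S y -> S (x + y))
         & (forall a x, S x -> S (a * x))].

Record ideal := Ideal {
  ideal_set :> set A;
  ideal_setP : ideal_closed ideal_set
}.

Lemma smallest_ideal_closed S : ideal_closed (smallest ideal_closed S).
Proof.
split=> [J [[J0 _ _] _] //|x y Sx Sy J CJ|b x Sx J CJ].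
- by have [[_ JD _] _] := CJ; apply: JD; [exact: Sx|exact: Sy].
- by have [[_ _ JM] _] := CJ; apply: JM; exact: Sx.
Qed.

Definition ideal_span S : ideal := Ideal (smallest_ideal_closed S).

Definition ideal_mul (I J : ideal) : ideal :=
  ideal_span [set z | exists2 x, I x & exists2 y, J y & z = x * y].

Definition ideal_exp (I : ideal) (n : nat) : ideal :=
  iter n (ideal_mul I) (ideal_span setT).

Definition principal_ideal (I : ideal) : Prop :=
  exists x, I = ideal_span [set x] :> set A.

Definition prime_ideal (P : ideal) : Prop :=
  ~ P 1 /\ forall x y, P (x * y) -> P x \/ P y.

Definition maximal_ideal (M : ideal) : Prop :=
  ~ M 1 /\ forall J : ideal, M `<=` J -> ~ J 1 -> J = M :> set A.

Definition noetherian : Prop :=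
  forall I : ideal, exists s : seq A, I = ideal_span [set` s] :> set A.

Definition artinian : Prop :=
  forall I : nat -> ideal, (forall n, I n.+1 `<=` I n) ->
  exists N, forall n, (N <= n)%N -> I n = I N :> set A.

Definition stretched : Prop :=
  artinian /\
  exists2 n : ideal,
    maximal_ideal n /\
      (forall M : ideal, maximal_ideal M -> M = n :> set A)
  & ideal_exp n 2 = [set 0] :> set A \/ principal_ideal (ideal_exp n 2).

Definition regular_sequence (s : seq A) : Prop :=
  ~ ideal_span [set` s] 1 /\
  forall i, (i < size s)%N -> forall y : A,
    ideal_span [set` take i s] (s`_i * y) -> ideal_span [set` take i s] y.

Definition has_depth (I : ideal) (d : nat) : Prop :=
  (exists s : seq A, [/\ regular_sequence s, [set` s] `<=` I & size s = d]) /\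
  (forall s : seq A,
     regular_sequence s -> [set` s] `<=` I -> (size s <= d)%N).

Definition prime_chain (M : ideal) (d : nat) (P : nat -> ideal) : Prop :=
  [/\ (forall i, (i <= d)%N -> prime_ideal (P i)),
      (forall i, (i < d)%N -> P i `<` P i.+1)
    & P d = M :> set A].

Definition has_height (M : ideal) (d : nat) : Prop :=
  (exists P, prime_chain M d P) /\
  (forall d' P, prime_chain M d' P -> (d' <= d)%N).

(* Eisenbud's form of the definition (Commutative Algebra, 18.2), with the    *)
(* depth of M measured in A instead of in the localization A_M.               *)
Definition cohen_macaulay : Prop :=
  noetherian /\
  forall M : ideal, maximal_ideal M ->
    exists2 d, has_depth M d & has_height M d.

End Ideals.

Section Quotient.
Variables (A : comPzRingType) (I : ideal A).

Definition ideal_mem : {pred A} := fun x => `[< I x >].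

Lemma ideal_memE x : (x \in ideal_mem) = `[< I x >]. Proof. by []. Qed.

Lemma ideal_mem_zmod_closed : zmod_closed ideal_mem.
Proof.
have [I0 ID IM] := ideal_setP I.
split=> [|x y]; first exact/asboolP.
move=> /asboolP Ix /asboolP Iy; apply/asboolP; apply: ID => //.
by rewrite -mulN1r; apply: IM.
Qed.
HB.instance Definition _ :=
  GRing.isZmodClosed.Build A ideal_mem ideal_mem_zmod_closed.

Definition quo : Type := Quotient.quot ideal_mem.
HB.instance Definition _ := GRing.Zmodule.on quo.

Local Open Scope quotient_scope.

Definition quo_pi (x : A) : quo := \pi_(Quotient.quot ideal_mem) x.
Definition quo_repr (x : quo) : A := repr (x : (Quotient.quot ideal_mem)).

Lemma quo_reprK x : quo_pi (quo_repr x) = x. Proof. exact: reprK. Qed.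

Lemma quo_piP x y : quo_pi x = quo_pi y <-> I (x - y).
Proof.
rewrite /quo_pi; split.
  by move/eqP; rewrite -Quotient.idealrBE ideal_memE => /asboolP.
by move=> Ixy; apply/eqP; rewrite -Quotient.idealrBE ideal_memE; apply/asboolP.
Qed.

Lemma quo_piD x y : quo_pi (x + y) = quo_pi x + quo_pi y.
Proof. by rewrite /quo_pi !piE. Qed.

Definition quo_one : quo := quo_pi 1.
Definition quo_mul (x y : quo) : quo := quo_pi (quo_repr x * quo_repr y).

Lemma quo_piM x y : quo_pi (x * y) = quo_mul (quo_pi x) (quo_pi y).
Proof.
have [I0 ID IM] := ideal_setP I.
have IB u : I (u - quo_repr (quo_pi u)) by apply/quo_piP; rewrite quo_reprK.
rewrite /quo_mul; apply/quo_piP.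
set x' := quo_repr _; set y' := quo_repr _.
have -> : x * y - x' * y' = y * (x - x') + x' * (y - y').
  by rewrite !mulrBr (mulrC y x) (mulrC y x') addrA subrK.
by apply: ID; apply: IM; apply: IB.
Qed.

Lemma quo_mulA : associative quo_mul.
Proof.
move=> x y z; rewrite -(quo_reprK x) -(quo_reprK y) -(quo_reprK z).
by rewrite -!quo_piM mulrA.
Qed.

Lemma quo_mulC : commutative quo_mul.
Proof. by move=> x y; rewrite /quo_mul mulrC. Qed.

Lemma quo_mul1 : left_id quo_one quo_mul.
Proof. by move=> x; rewrite -(quo_reprK x) -quo_piM mul1r. Qed.

Lemma quo_mulD : left_distributive quo_mul +%R.
Proof.
move=> x y z; rewrite -(quo_reprK x) -(quo_reprK y) -(quo_reprK z).
by rewrite -quo_piD -!quo_piM mulrDl quo_piD.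
Qed.

HB.instance Definition _ := GRing.Zmodule_isComPzRing.Build quo
  quo_mulA quo_mulC quo_mul1 quo_mulD.

End Quotient.

(* The associated graded ring (+)_i I^i / I^(i+1), presented as the quotient  *)
(* of (+)_i I^i by (+)_i I^(i+1). An element (c_i)_i of (+)_i I^i is encoded  *)
(* as the polynomial \sum_i c_i X^i, whose product is the graded one.         *)

Section AssociatedGraded.
Variables (A : comNzRingType) (I : ideal A).

Lemma ideal_spanS (S : set A) : S `<=` ideal_span S.
Proof. by move=> x Sx J [_]; apply. Qed.

Lemma ideal_span_sub (S : set A) (J : ideal A) :
  S `<=` J -> ideal_span S `<=` J.
Proof. by move=> SJ x; apply; split=> //; exact: ideal_setP. Qed.

Lemma ideal_exp0 x : ideal_exp I 0 x.
Proof. exact: ideal_spanS. Qed.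

Lemma ideal_expS n x y : I x -> ideal_exp I n y -> ideal_exp I n.+1 (x * y).
Proof. by move=> Ix Iy; apply: ideal_spanS; exists x => //; exists y. Qed.

Lemma ideal_expD i j x y :
  ideal_exp I i x -> ideal_exp I j y -> ideal_exp I (i + j) (x * y).
Proof.
elim: i x => [|i IHi] x Ix Iy.
  by have [_ _] := ideal_setP (ideal_exp I j); apply.
have [K0 KD KM] := ideal_setP (ideal_exp I (i.+1 + j)).
have JP : ideal_closed [set z | ideal_exp I (i.+1 + j) (z * y)].
  split=> [|u v /= Iu Iv|b u /= Iu]; first by rewrite /= mul0r.
  - by rewrite mulrDl; apply: KD.
  - by rewrite -mulrA; apply: KM.
apply: (@ideal_span_sub _ (Ideal JP)) Ix => _ [u Iu [v Iv ->]] /=.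
by rewrite -mulrA; apply: (ideal_expS Iu); exact: IHi.
Qed.

Lemma ideal_exp_sum n (T : Type) (r : seq T) (F : T -> A) :
  (forall t, ideal_exp I n (F t)) -> ideal_exp I n (\sum_(t <- r) F t).
Proof.
have [K0 KD _] := ideal_setP (ideal_exp I n).
by move=> IF; apply: (big_ind (ideal_exp I n)).
Qed.

Definition graded_mem : {pred {poly A}} :=
  fun p => `[< forall i, ideal_exp I i p`_i >].

Lemma graded_mem_subring_closed : subring_closed graded_mem.
Proof.
split=> [|p q /asboolP Ip /asboolP Iq|p q /asboolP Ip /asboolP Iq];
    apply/asboolP => i.
- rewrite coef1; case: i => [|i] /=; first exact: ideal_exp0.
  by have [] := ideal_setP (ideal_exp I i.+1).
- have [_ KD KM] := ideal_setP (ideal_exp I i).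
  by rewrite coefB -mulN1r; apply: KD => //; apply: KM.
- rewrite coefM; apply: ideal_exp_sum => j.
  by rewrite -{1}(subnKC (leq_ord j)); apply: ideal_expD.
Qed.
HB.instance Definition _ :=
  GRing.isSubringClosed.Build _ graded_mem graded_mem_subring_closed.

Record graded_sum := GradedSum {
  graded_poly :> {poly A};
  graded_polyP : graded_poly \in graded_mem
}.
HB.instance Definition _ := [isSub for graded_poly].
HB.instance Definition _ := [Choice of graded_sum by <:].
HB.instance Definition _ :=
  [SubChoice_isSubComNzRing of graded_sum by <:].

Lemma graded_shift_closed :
  ideal_closed [set p : graded_sum | forall i, ideal_exp I i.+1 p`_i].
Proof.
split=> [i|p q /= Ip Iq i|p q /= Iq i].
- by rewrite coef0; have [] := ideal_setP (ideal_exp I i.+1).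
- rewrite coefD; have [_ ID _] := ideal_setP (ideal_exp I i.+1).
  by apply: ID; [exact: Ip|exact: Iq].
- rewrite coefM; apply: (@ideal_exp_sum i.+1) => j.
  rewrite -{1}(subnKC (leq_ord j)) -addnS; apply: ideal_expD; last exact: Iq.
  by case: p => p /= /asboolP.
Qed.

Definition graded_shift : ideal graded_sum := Ideal graded_shift_closed.

Definition assoc_graded : Type := quo graded_shift.
HB.instance Definition _ := GRing.ComPzRing.on assoc_graded.

End AssociatedGraded.

Section NumericalSemigroups.
Implicit Types (G H M : set nat).

Definition submonoid M : Prop :=
  M 0%N /\ forall x y, M x -> M y -> M (x + y)%N.

Definition numerical_semigroup H : Prop :=
  exists s : seq nat,
    [/\ all (leq 1) s, \big[gcdn/0%N]_(x <- s) x = 1%N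
      & H = smallest submonoid [set` s]].

Definition minimal_generators H G : Prop :=
  smallest submonoid G = H /\
  forall G', G' `<=` G -> smallest submonoid G' = H -> G' = G.

Definition embedding_dimension H (n : nat) : Prop :=
  exists2 G, minimal_generators H G & (G #= `I_n)%card.

Definition multiplicity H (a : nat) : Prop :=
  [/\ H a, (0 < a)%N & forall s, H s -> (0 < s)%N -> (a <= s)%N].

Definition pseudo_frobenius H : set int :=
  [set z | ~ (Posz @` H) z /\
           forall s : nat, H s -> (0 < s)%N -> (Posz @` H) (z + s%:Z)].

End NumericalSemigroups.

Section SemigroupRing.
Variables (k : fieldType) (H : set nat).

Definition sgring_mem : {pred {poly k}} :=
  fun p => `[< smallest (fun S : set {poly k} => subalg_closed (mem S))
                 [set 'X^s | s in H] p >].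

Lemma sgring_mem_subalg_closed : subalg_closed sgring_mem.
Proof.
split=> [|c p q /asboolP Sp /asboolP Sq|p q /asboolP Sp /asboolP Sq];
    apply/asboolP => S CS; apply/set_mem; have [[S1 SL SM] _] := CS => //.
- by apply: SL; apply/mem_set; [exact: Sp|exact: Sq].
- by apply: SM; apply/mem_set; [exact: Sp|exact: Sq].
Qed.
HB.instance Definition _ :=
  GRing.isSubalgClosed.Build _ _ sgring_mem sgring_mem_subalg_closed.

Record sgring := SgRing {
  sgring_poly :> {poly k};
  sgring_polyP : sgring_poly \in sgring_mem
}.
HB.instance Definition _ := [isSub for sgring_poly].
HB.instance Definition _ := [Choice of sgring by <:].
HB.instance Definition _ := [SubChoice_isSubComNzRing of sgring by <:].

Lemma sgring_memP (p : {poly k}) : submonoid H ->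
  (p \in sgring_mem) <-> (forall i, p`_i != 0 -> H i).
Proof.
move=> [H0 HD]; split; last first.
  move=> Hp; apply/asboolP => S [[S1 SL SM] HS].
  have S0 : 0 \in mem S by have := SL (-1) _ _ S1 S1; rewrite scaleN1r addNr.
  apply/set_mem; rewrite -[p]coefK poly_def.
  apply: (big_ind (fun q => q \in S)) => // [u v Su Sv|i _].
    by rewrite -[u]scale1r; apply: SL.
  have [->|pi_neq0] := eqVneq p`_i 0; first by rewrite scale0r.
  rewrite -[_ *: _]addr0; apply: SL => //.
  by apply/mem_set; apply: HS; exists (i : nat) => //; apply: Hp.
move/asboolP => /(_ [set q | forall i, q`_i != 0 -> H i]); apply; split.
  split=> [|c u v|u v].
  - apply/mem_set => i; rewrite coef1.
    by case: i => [|i] //=; rewrite eqxx.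
  - move=> /set_mem Hu /set_mem Hv; apply/mem_set => i; rewrite coefD coefZ.
    have [u0|/Hu//] := eqVneq u`_i 0.
    by rewrite u0 mulr0 add0r => /Hv.
  - move=> /set_mem Hu /set_mem Hv; apply/mem_set => i; rewrite coefM => nz.
    have [//|nHi] := pselect (H i).
    case/eqP: nz; rewrite big1 // => j _; apply/eqP; apply: contra_notT nHi.
    rewrite mulf_eq0 negb_or => /andP[uj vj].
    by rewrite -(subnKC (leq_ord j)); apply: HD; [apply: Hu|apply: Hv].
move=> _ [s Hs <-] i /=; rewrite coefXn.
by have [->|_] := eqVneq i s; rewrite ?eqxx.
Qed.

Definition sgring_max : ideal sgring :=
  ideal_span [set f : sgring | exists s, [/\ H s, (0 < s)%N & f = 'X^s :> {poly k}]].

Definition sgring_power (a : nat) : ideal sgring :=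
  ideal_span [set f : sgring | f = 'X^a :> {poly k}].

End SemigroupRing.

(* Main.v *)
From HB Require Import structures.
Require Import Defs.
From mathcomp Require Import all_boot all_order all_algebra.
From mathcomp Require Import boolp classical_sets cardinality.
From mathcomp Require Import zify.

(* Write T_t = h + (t + 1) alpha + a = l b + t alpha for 0 <= t <= n - 2.
   Since T_t - a is pseudo-Frobenius, T_t is not in a + H, but T_t + s is for
   every positive s in H. So the Apery set of a is
   {0, b, ..., l b, T_1, ..., T_(n-2)}, and these a = l + n - 1 elements have
   distinct residues modulo a. The residue of (l - 1) b + alpha can only be
   that of l b, so b = alpha + c a with c >= 1 (as T_1 is not in a + H), and
   h1 = c - 1.

   The ring gr has a basis x_s (s in H), with x_s in degree ord s, and
   x_s x_t = x_(s+t) if ord (s + t) = ord s + ord t, and 0 otherwise. Its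
   reduction is k[x_a], so every maximal ideal has height 1. If
   ord (w + i a) = ord w + i for all w in the Apery set, then gr is free over
   k[x_a], hence Cohen-Macaulay. Otherwise some x_s is killed by x_a, such an
   x_s with s - a ord s maximal lies in the socle, and the depth at the graded
   maximal ideal is 0. If c >= l, the weights ord (j b) = j, ord T_t = 1 for
   t >= 1 are superadditive; if c < l, then T_1 has order 1, whereas
   T_1 + c a = (l + 1) b has order at least l + 1 > 1 + c. *)

Set Implicit Arguments.
Unset Strict Implicit.
Unset Printing Implicit Defensive.

Import GRing.Theory.
Local Open Scope classical_set_scope.
Local Open Scope nat_scope.

(** * Rings retracting onto k[X] with nilpotent kernel *)

Section IdealFacts.
Local Open Scope ring_scope.
Variable A : comPzRingType.
Implicit Types (S : set A) (I J : ideal A).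

Lemma ideal0 I : I 0. Proof. by have [] := ideal_setP I. Qed.

Lemma idealD I x y : I x -> I y -> I (x + y).
Proof. by have [_ + _] := ideal_setP I; apply. Qed.

Lemma idealM I a x : I x -> I (a * x).
Proof. by have [_ _] := ideal_setP I; apply. Qed.

Lemma idealN I x : I x -> I (- x).
Proof. by rewrite -mulN1r; exact: idealM. Qed.

Lemma idealB I x y : I x -> I y -> I (x - y).
Proof. by move=> Ix Iy; apply: idealD => //; exact: idealN. Qed.

Lemma ideal_span_incl S : S `<=` ideal_span S.
Proof. by move=> x Sx J [_]; apply. Qed.

Lemma ideal_span_min S J : S `<=` J -> ideal_span S `<=` J.
Proof. by move=> SJ x; apply; split=> //; exact: ideal_setP. Qed.

Lemma ideal_span_nil (x : A) : ideal_span [set` ([::] : seq A)] x -> x = 0.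
Proof.
suff h : ideal_span [set` ([::] : seq A)] `<=` [set (0 : A)] by move=> /h.
apply: smallest_sub => //.
by split=> [//|u v -> ->|c u ->] /=; rewrite ?addr0 ?mulr0.
Qed.

Lemma maximal_ideal_prime I : maximal_ideal I -> prime_ideal I.
Proof.
move=> [I1 maxI]; split=> // x y Ixy; have [Ix|nIx] := pselect (I x); first by left.
right; pose J := [set z | exists2 u, I u & exists c, z = u + c * x].
have JP : ideal_closed J.
  split=> [|_ _ [u Iu [c ->]] [v Iv [d ->]]|e _ [u Iu [c ->]]].
  - by exists 0; [exact: ideal0|exists 0; rewrite mul0r addr0].
  - by exists (u + v); [exact: idealD|exists (c + d); rewrite mulrDl addrACA].
  - by exists (e * u); [exact: idealM|exists (e * c); rewrite mulrDr mulrA].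
have IJ : I `<=` Ideal JP by move=> u Iu; exists u => //; exists 0; rewrite mul0r addr0.
have [/= [u Iu [c e1]]|J1] := pselect (Ideal JP 1).
  rewrite -[y]mul1r e1 mulrDl -mulrA mulrC.
  by apply: idealD; apply: idealM.
have JI := maxI (Ideal JP) IJ J1.
case: nIx; rewrite -JI; exists 0; first exact: ideal0.
by exists 1; rewrite mul1r add0r.
Qed.

Lemma prime_ideal_exp I x N : prime_ideal I -> I (x ^+ N) -> I x.
Proof.
move=> [I1 primeI]; elim: N => [|N IHN]; first by rewrite expr0.
by rewrite exprS => /primeI [].
Qed.

End IdealFacts.

Section PolynomialIdeals.
Local Open Scope ring_scope.
Variable k : fieldType.

Lemma poly_ideal_principal (J : set {poly k}) :
  ideal_closed J -> exists2 g, J g & forall f, J f -> exists q, f = q * g.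
Proof.
move=> [J0 JD JM].
have [nzJ|zJ] := pselect (exists f, J f /\ f != 0); last first.
  exists 0 => // f Jf; exists 0; rewrite mulr0; apply/eqP.
  by apply: contra_notT zJ => nzf; exists f.
pose P n := `[< exists f, [/\ J f, f != 0 & size f = n] >].
have exP : exists n, P n.
  by have [f [Jf nzf]] := nzJ; exists (size f); apply/asboolP; exists f.
case: (ex_minnP exP) => n /asboolP [g [Jg nzg szg]] min_n.
exists g => // f Jf; exists (f %/ g); apply/eqP.
rewrite {1}(divp_eq f g) addrC -subr_eq0 addrK; apply/negP => /negP nzr.
have Jr : J (f %% g).
  have -> : f %% g = f + (- (f %/ g)) * g.
    by rewrite {2}(divp_eq f g) mulNr addrC addKr.
  by apply: JD => //; apply: JM.
have : (n <= size (f %% g)%R)%N by apply: min_n; apply/asboolP; exists (f %% g).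
by rewrite -szg leqNgt ltn_modp nzg.
Qed.

End PolynomialIdeals.

Section PolyRetract.
Local Open Scope ring_scope.
Variables (k : fieldType) (A : comPzRingType).
Variables (phi : {rmorphism A -> {poly k}}) (sigma : {rmorphism {poly k} -> A}).
Hypothesis sigmaK : cancel sigma phi.
Hypothesis ker_nilp : forall x, phi x = 0 -> exists N, x ^+ N = 0.
Implicit Types (P Q M : ideal A).

Lemma nilp_part x : exists N, (x - sigma (phi x)) ^+ N = 0.
Proof. by apply: ker_nilp; rewrite rmorphB /= sigmaK subrr. Qed.

Lemma prime_ker P x : prime_ideal P -> phi x = 0 -> P x.
Proof.
move=> primeP /ker_nilp [N xN]; apply: (prime_ideal_exp (N := N)) => //.
by rewrite xN; exact: ideal0.
Qed.

(** [x - sigma (phi x)] is nilpotent, so it lies in every prime; primes of [A] are determined by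
    their traces on [k[X]]. *)
Lemma prime_sigma_phi P x : prime_ideal P -> P x <-> P (sigma (phi x)).
Proof.
move=> primeP; have Pn : P (x - sigma (phi x)).
  by apply: prime_ker => //; rewrite rmorphB /= sigmaK subrr.
split=> [Px|Ps].
  by rewrite -[sigma _](subKr x); apply: idealB.
by rewrite -[x](subrK (sigma (phi x))); apply: idealD.
Qed.

Lemma prime_gen P : prime_ideal P ->
  exists2 g, P (sigma g) & forall x, P x -> exists q, phi x = q * g.
Proof.
move=> primeP; have [|g Pg gP] := @poly_ideal_principal k [set f | P (sigma f)].
  split=> [|f g Pf Pg|c f Pf] /=; first by rewrite rmorph0; exact: ideal0.
  - by rewrite rmorphD; apply: idealD.
  - by rewrite rmorphM; apply: idealM.
by exists g => // x Px; apply: gP; apply/(prime_sigma_phi x primeP).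
Qed.

Lemma ker_closed : ideal_closed [set x | phi x = 0].
Proof.
split=> [|x y /= hx hy|c x /= hx]; first exact: rmorph0.
- by rewrite rmorphD hx hy addr0.
- by rewrite rmorphM hx mulr0.
Qed.
Definition ker_ideal : ideal A := Ideal ker_closed.

Lemma ker_prime : prime_ideal ker_ideal.
Proof.
split=> [/=|x y /=]; first by rewrite rmorph1; apply/eqP; exact: oner_neq0.
by rewrite rmorphM => /eqP; rewrite mulf_eq0 => /orP [] /eqP; [left|right].
Qed.

(* [ker_ideal] itself is not maximal: it is properly contained in the ideal
   of the elements whose image is divisible by ['X]. *)
Lemma maximal_gen_neq0 M g : maximal_ideal M ->
  (forall x, M x -> exists q, phi x = q * g) -> g != 0.
Proof.
move=> maxM gP; apply/eqP => g0.
have kerM x : M x -> phi x = 0 by move=> /gP [q ->]; rewrite g0 mulr0.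
pose J := [set x | exists q, phi x = q * 'X].
have JP : ideal_closed J.
  split=> [|x y [u hu] [v hv]|c x [u hu]].
  - by exists 0; rewrite rmorph0 mul0r.
  - by exists (u + v); rewrite rmorphD hu hv mulrDl.
  - by exists (phi c * u); rewrite rmorphM hu mulrA.
have MJ : M `<=` Ideal JP by move=> x /kerM hx; exists 0; rewrite mul0r.
have J1 : ~ Ideal JP 1.
  move=> [q]; rewrite rmorph1 => /(congr1 (fun f => f.[0])).
  by rewrite hornerM hornerX mulr0 hornerC; apply/eqP; exact: oner_neq0.
have [_ maxM'] := maxM; have JM := maxM' (Ideal JP) MJ J1.
have : M (sigma 'X) by rewrite -JM; exists 1; rewrite sigmaK mul1r.
by move/kerM; rewrite sigmaK; apply/eqP; rewrite polyX_eq0.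
Qed.

(** Nonzero primes of [k[X]] are maximal: [g = q * g2] in the prime [Q] makes [g2] a unit or puts
    [M] inside [Q]. *)
Lemma prime_chain2 (P Q M : ideal A) :
    prime_ideal P -> prime_ideal Q -> prime_ideal M ->
  P `<` Q -> Q `<` M -> False.
Proof.
move=> pP pQ pM [PQ nPQ] [QM nQM].
have [g Qg gP] := prime_gen pQ; have [g2 Mg2 g2P] := prime_gen pM.
have nzg : g != 0.
  apply/eqP => g0; apply: nPQ => x /gP [q hx].
  by apply: prime_ker => //; rewrite hx g0 mulr0.
have [q] := g2P _ (QM _ Qg); rewrite sigmaK => hg.
have [_ /(_ (sigma q) (sigma g2))] := pQ; rewrite -rmorphM -hg => /(_ Qg) [] Hq.
  have [e] := gP _ Hq; rewrite sigmaK => hq.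
  have : M (sigma (e * g2)) by rewrite rmorphM; apply: idealM.
  have -> : e * g2 = 1.
    by apply: (mulfI nzg); rewrite mulr1 mulrA [g * e]mulrC -hq -hg.
  by rewrite rmorph1; case: pM.
apply: nQM => x Mx.
apply/(prime_sigma_phi x pQ); have [e ->] := g2P _ Mx.
by rewrite rmorphM; apply: idealM.
Qed.

Lemma maximal_height M : maximal_ideal M -> has_height M 1.
Proof.
move=> maxM; have primeM := maximal_ideal_prime maxM.
split=> [|d P [primeP ltP _]]; last first.
  case: d primeP ltP => [|[|d]] // primeP ltP.
  exfalso; apply: (@prime_chain2 (P 0%N) (P 1%N) (P 2%N)).
  - exact: primeP.
  - exact: primeP.
  - exact: primeP.
  - exact: ltP.
  - exact: ltP.
exists (fun i => if i is 0%N then ker_ideal else M); split=> //.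
  by case=> [_|i _] //; exact: ker_prime.
case=> // _; split=> [x|]; first exact: prime_ker.
have [g Mg gP] := prime_gen primeM.
by move/(_ _ Mg) => /=; rewrite sigmaK; apply/eqP; exact: maximal_gen_neq0 gP.
Qed.

Lemma regular_head_exp (r : A) s : regular_sequence (r :: s) ->
  forall y N, r ^+ N * y = 0 -> y = 0.
Proof.
move=> [_ /(_ 0%N isT)]; rewrite take0 /= => reg y; elim=> [|N IHN].
  by rewrite expr0 mul1r.
rewrite exprS -mulrA => h; apply: IHN; apply: ideal_span_nil; apply: reg.
by rewrite h; exact: (ideal0 (ideal_span _)).
Qed.

(* If [g] is a nonzero polynomial of least degree with [sigma g] in [(r1)],
   and [g = q * f] with [f] the generator of the image of [M], then
   [sigma q] is a nonzero element of the quotient by [r1] on which every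
   element of [M] acts nilpotently. *)
Lemma maximal_depth_le M s : maximal_ideal M -> regular_sequence s ->
  [set` s] `<=` M -> (size s <= 1)%N.
Proof.
move=> maxM; have primeM := maximal_ideal_prime maxM.
case: s => [|r1 [|r2 s]] // reg sM; exfalso.
have Mr1 : M r1 by apply: sM; rewrite /= inE eqxx.
have Mr2 : M r2 by apply: sM; rewrite /= !inE eqxx orbT.
have [f Mf fP] := prime_gen primeM.
move P1E: (ideal_span [set` [:: r1]]) => P1.
have Pr1 : P1 r1 by rewrite -P1E; apply: ideal_span_incl; rewrite /= inE.
(* Applied with [y] nilpotent, this puts a power of [x - y] in the ideal of [x]. *)
have subX (x y : A) N : exists c, (x - y) ^+ N = x * c + (- y) ^+ N.
  elim: N => [|N [c hc]]; first by exists 0; rewrite !expr0 mulr0 add0r.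
  exists ((x - y) ^+ N - y * c); rewrite exprS mulrBl {2}hc mulrDr.
  by rewrite mulrBr [y * (x * c)]mulrCA exprS mulNr opprD addrA.
have [g [nzg Pg ming]] : exists g, [/\ g != 0, P1 (sigma g) &
    forall g', g' != 0 -> P1 (sigma g') -> (size g <= size g')%N].
  pose P n := `[< exists g, [/\ P1 (sigma g), g != 0 & size g = n] >].
  have exP : exists n, P n.
    have [N hN] := nilp_part r1; pose p := phi r1.
    exists (size (p ^+ N)); apply/asboolP; exists (p ^+ N); split=> //.
      rewrite rmorphXn /=; have [c hc] := subX r1 (r1 - sigma p) N.
      rewrite subKr in hc; rewrite hc exprNn hN mulr0 addr0 mulrC.
      exact: idealM.
    (* Were [phi r1] zero, [r1] would be both nilpotent and regular, forcing [1 = 0]. *)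
    apply/eqP => /eqP; rewrite expf_eq0 => /andP [_ /eqP p0].
    case: maxM => + _; apply.
    have [K hK] := ker_nilp p0.
    have -> : (1 : A) = 0.
      by apply: (regular_head_exp reg (N := K)); rewrite hK mul0r.
    exact: ideal0.
  case: (ex_minnP exP) => n /asboolP [g [Pg nzg szg]] min_n.
  exists g; split=> // g' nzg' Pg'; rewrite szg; apply: min_n.
  by apply/asboolP; exists g'.
have Mg : M (sigma g).
  by move: Pg; rewrite -P1E; apply: ideal_span_min => x /=; rewrite inE => /eqP ->.
have [q] := fP _ Mg; rewrite sigmaK => hg.
have nzq : q != 0 by apply: contra_neq nzg => q0; rewrite hg q0 mul0r.
have nzf : f != 0 by apply: contra_neq nzg => q0; rewrite hg q0 mulr0.
have nPq : ~ P1 (sigma q).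
  move=> /(ming _ nzq); rewrite hg size_mul // leqNgt.
  have f1 : (1 < size f)%N.
    rewrite ltnNge; apply/negP => sf; have [M1 _] := maxM; apply: M1.
    move: nzf Mf; rewrite [f]size1_polyC // polyC_eq0 => c0 Mf.
    rewrite -(rmorph1 sigma) -polyC1 -(mulVf c0) polyCM rmorphM.
    exact: idealM.
  have : (0 < size q)%N by rewrite size_poly_gt0.
  by case: (size q) => // sq _; rewrite addSn /= -addn1 ltn_add2l f1.
apply: nPq.
have [N hN] := nilp_part r2; have [e he] := fP _ Mr2.
have P2 : P1 (r2 ^+ N * sigma q).
  have -> : r2 = sigma (phi r2) - (sigma (phi r2) - r2) by rewrite subKr.
  have [c ->] := subX (sigma (phi r2)) (sigma (phi r2) - r2) N.
  rewrite opprB hN addr0 he !rmorphM mulrAC [_ * sigma q]mulrAC -mulrA.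
  have -> : sigma e * (sigma q) * (sigma f * c) = (sigma e * c) * sigma g.
    rewrite hg rmorphM -!mulrA; congr (_ * _).
    by rewrite [in LHS]mulrA [in LHS]mulrC.
  exact: idealM.
have [_ /(_ 1%N isT)] := reg; rewrite [take _ _]/= ?take0 P1E [nth _ _ _]/= => reg2.
elim: N P2 {hN} => [|N IHN]; first by rewrite expr0 mul1r.
by rewrite exprS -mulrA => /reg2.
Qed.

Lemma regular_seq1 (M : ideal A) r : maximal_ideal M -> M r ->
  (forall y, r * y = 0 -> y = 0) -> regular_sequence [:: r].
Proof.
move=> [M1 _] Mr reg; split=> [|[|//] _ y].
  by move/(@ideal_span_min _ _ M) => h; apply: M1; apply: h => x /=; rewrite inE => /eqP ->.
rewrite take0 /= => /ideal_span_nil /reg ->; exact: (ideal0 (ideal_span _)).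
Qed.

(** Through the maps [C j] with [j < m], [A] embeds into a free [k[X]]-module. Hence [sigma g] is a
    nonzerodivisor for nonzero [g], which bounds the depth below by 1. *)
Lemma cohen_macaulay_free m (C : nat -> A -> {poly k}) :
    (forall j x y, C j (x - y) = C j x - C j y) ->
    (forall j f x, C j (sigma f * x) = f * C j x) ->
    (forall x, (forall j, (j < m)%N -> C j x = 0) -> x = 0) ->
  cohen_macaulay A.
Proof.
move=> CB CZ Cinj.
have C0 j : C j 0 = 0 by rewrite -(subr0 0) CB subrr.
have CN j x : C j (- x) = - C j x by rewrite -sub0r CB C0 sub0r.
have CD j x y : C j (x + y) = C j x + C j y by rewrite -{1}(opprK y) CB CN opprK.
split=> [I|M maxM]; last first.
  exists 1%N; last exact: maximal_height.
  split; last by move=> s reg sM; exact: maximal_depth_le reg sM.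
  have [g Mg gP] := prime_gen (maximal_ideal_prime maxM).
  have nzg := maximal_gen_neq0 maxM gP.
  exists [:: sigma g]; split=> //; last by move=> x /=; rewrite inE => /eqP ->.
  apply: (regular_seq1 maxM Mg) => y hy; apply: Cinj => j _.
  by apply: (mulfI nzg); rewrite -CZ hy C0 mulr0.
suff [s sI Is] : exists2 s : seq A, [set` s] `<=` I &
    forall x, I x -> (forall j, (m <= j < m)%N -> C j x = 0) ->
    ideal_span [set` s] x.
  exists s; apply/seteqP; split=> [x Ix|]; last exact: ideal_span_min.
  by apply: Is => // j; case: leqP.
(* Induction on the index [i] from which the coordinates vanish. The [i]-th coordinates form a
   principal ideal [J], and a lift [y] of its generator joins [s]. *)
elim: {1 3}m (leqnn m) => [_|i IHi /ltnW lim].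
  by exists [::] => // x _ /Cinj ->; exact: ideal0.
have [s sI Is] := IHi lim.
pose J := [set f | exists2 x, I x & f = C i x /\
  forall j, (i < j < m)%N -> C j x = 0].
have [|g [y Iy [gy y0]] gP] := @poly_ideal_principal k J.
  split=> [|_ _ [x Ix [-> x0]] [y Iy [-> y0]]|f _ [x Ix [-> x0]]].
  - by exists 0; [exact: ideal0|split=> [|j _]; rewrite C0].
  - exists (x + y); [exact: idealD|split=> [|j jm]; rewrite CD //].
    by rewrite x0 // y0 // addr0.
  - exists (sigma f * x); [exact: idealM|split=> [|j jm]; rewrite CZ //].
    by rewrite x0 // mulr0.
exists (y :: s) => [x /=|x Ix x0].
  by rewrite inE => /orP [/eqP -> //|]; exact: sI.
have [|q hq] := gP (C i x); first by exists x.
rewrite -[x](subrK (sigma q * y)); apply: idealD; last first.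
  by apply: idealM; apply: ideal_span_incl; rewrite /= inE eqxx.
have : ideal_span [set` s] (x - sigma q * y).
  apply: Is => [|j /andP [ij jm]]; first by apply: idealB => //; apply: idealM.
  rewrite CB CZ; move: ij; rewrite leq_eqVlt => /predU1P [<-|ij].
    by rewrite hq gy subrr.
  by rewrite x0 ?ij // y0 ?ij // mulr0 subrr.
apply: ideal_span_min => z zs; apply: ideal_span_incl.
by rewrite /= inE zs orbT.
Qed.

(** The elements whose image vanishes at 0 form a maximal ideal of height 1. All of them kill [z],
    so its depth is 0. *)
Lemma not_cohen_macaulay_socle z : z != 0 ->
  (forall x, (phi x)`_0 = 0 -> x * z = 0) -> ~ cohen_macaulay A.
Proof.
move=> nzz soc [_ CM]; pose M0 := [set x | (phi x)`_0 = 0].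
have M0P : ideal_closed M0.
  rewrite /M0; split=> [|x y /= hx hy|c x /= hx] /=.
  - by rewrite rmorph0 coef0.
  - by rewrite rmorphD coefD hx hy addr0.
  - by rewrite rmorphM coef0M hx mulr0.
pose M := Ideal M0P.
have maxM : maximal_ideal M.
  split=> [/=|J MJ nJ1].
    by rewrite /M0 /= rmorph1 coef1; apply/eqP; exact: oner_neq0.
  apply/seteqP; split=> // y Jy; apply: contra_notP nJ1 => nMy.
  pose c := (phi y)`_0; have c0 : c != 0 by apply/eqP.
  have Jc : J (sigma c%:P).
    rewrite -[sigma _](subKr y); apply: idealB => //; apply: MJ => /=.
    by rewrite /M0 /= rmorphB /= sigmaK coefB coefC subrr.
  rewrite -(rmorph1 sigma) -polyC1 -(mulVf c0) polyCM rmorphM.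
  exact: idealM.
have [d [[s [reg sM sd]] _] [_ hd]] := CM M maxM.
have [[P chP] _] := maximal_height maxM.
move: (hd _ _ chP); rewrite -sd; case: s reg sM {sd} => // r s reg sM _.
case/eqP: nzz; apply: (regular_head_exp reg (N := 1)); rewrite expr1.
by apply: soc; apply: sM; rewrite /= inE eqxx.
Qed.

End PolyRetract.

(** * Powers of the maximal ideal of a semigroup ring *)

Section OrderFiltration.
Local Open Scope nat_scope.
Variable H : set nat.
Hypothesis monoidH : submonoid H.

(* [ord_ge i s]: the monomial [t^s] lies in the [i]-th power of the maximal
   ideal of the semigroup ring. *)
Fixpoint ord_ge (i : nat) : set nat :=
  if i is j.+1 then [set s | exists x y, [/\ H x, 0 < x, ord_ge j y & s = x + y]]
  else H.

Lemma ord_ge_mem i s : ord_ge i s -> H s.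
Proof.
have [_ HD] := monoidH; elim: i s => //= i IHi _ [x [y [Hx _ /IHi Hy ->]]].
exact: HD.
Qed.

Lemma ord_ge_add i j s t : ord_ge i s -> ord_ge j t -> ord_ge (i + j) (s + t).
Proof.
have [_ HD] := monoidH; elim: i s => [|i IHi] s.
  elim: j t => [|j IHj] t Hs; first exact: HD.
  move=> [x [y [Hx x0 Dy ->]]]; exists x, (s + y); split=> //.
    by rewrite -[j]add0n; apply: IHj.
  by rewrite addnCA.
move=> [x [y [Hx x0 Dy ->]]] Dt; exists x, (y + t); split=> //; last by rewrite addnA.
exact: IHi.
Qed.

Lemma ord_ge_leq i j s : i <= j -> ord_ge j s -> ord_ge i s.
Proof.
elim: j s => [|j IHj] s; first by case: i.
rewrite leq_eqVlt ltnS => /predU1P [-> //|ij] [x [y [Hx _ Dy ->]]].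
by rewrite -[i]add0n; apply: ord_ge_add => //; exact: IHj.
Qed.

Lemma ord_ge_gt0 i s : 0 < i -> ord_ge i s -> 0 < s.
Proof. by case: i => // i _ [x [y [_ x0 _ ->]]]; rewrite addn_gt0 x0. Qed.

Lemma ord_ge1 s : H s -> 0 < s -> ord_ge 1 s.
Proof. by move=> Hs s0; exists s, 0; split; rewrite ?addn0 //; case: monoidH. Qed.

Variable a : nat.
Hypothesis multH : multiplicity H a.

Lemma ord_ge_bound i s : ord_ge i s -> i * a <= s.
Proof.
have [_ _ min_a] := multH; elim: i s => //= i IHi _ [x [y [Hx x0 /IHi iy ->]]].
by rewrite mulSn leq_add // min_a.
Qed.

Lemma ord_ge_mul k : ord_ge k (k * a).
Proof.
have [Ha a0 _] := multH; elim: k => [|k IHk]; first by case: monoidH.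
by exists a, (k * a); split; rewrite // mulSn.
Qed.

End OrderFiltration.
Arguments ord_ge : simpl never.

Section SemigroupRingPowers.
Local Open Scope ring_scope.
Variables (k : fieldType) (H : set nat).
Hypothesis monoidH : submonoid H.
Implicit Types f g : sgring k H.
Local Notation m := (sgring_max k H).

(** The default 0 is harmless: arguments are always supported in [H]. *)
Definition mk_sgring (p : {poly k}) : sgring k H := insubd 0 p.

Lemma mk_sgringE (p : {poly k}) : (forall i, p`_i != 0 -> H i) -> mk_sgring p = p :> {poly k}.
Proof. by move=> Hp; rewrite /mk_sgring [LHS]insubdK //; apply/sgring_memP. Qed.

Lemma sgring_supp f i : f`_i != 0 -> H i.
Proof. by move: i; apply/sgring_memP => //; exact: sgring_polyP. Qed.

Lemma sgring_inj f g : f = g :> {poly k} -> f = g.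
Proof. exact: val_inj. Qed.

Lemma sgringB f g : f - g = (f : {poly k}) - (g : {poly k}) :> {poly k}.
Proof. by []. Qed.

Lemma sgringM f g : f * g = (f : {poly k}) * (g : {poly k}) :> {poly k}.
Proof. by []. Qed.

Lemma sgring_sum (I : Type) (r : seq I) (F : I -> sgring k H) :
  \sum_(i <- r) F i = \sum_(i <- r) (F i : {poly k}) :> {poly k}.
Proof. by rewrite [LHS](raddf_sum (val : sgring k H -> {poly k})). Qed.

Lemma mk_sgring_monE c u : H u -> mk_sgring (c *: 'X^u) = c *: 'X^u :> {poly k}.
Proof.
move=> Hu; apply: mk_sgringE => i; rewrite coefZ coefXn.
by have [->|] := eqVneq i u; rewrite ?mulr0 ?eqxx.
Qed.

Lemma sgring_coefM f g u : (f * g)`_u != 0 ->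
  exists x y, [/\ u = (x + y)%N, f`_x != 0 & g`_y != 0].
Proof.
rewrite coefM; apply: contra_neqP => nex; rewrite big1 // => j _.
apply/eqP/negP => /negP; rewrite mulf_eq0 negb_or => /andP [fj gj].
by apply: nex; exists j, (u - j)%N; split; rewrite // subnKC // -ltnS.
Qed.

Lemma supp_closed i :
  ideal_closed [set f : sgring k H | forall u, f`_u != 0 -> ord_ge H i u].
Proof.
split=> [u|f g /= Df Dg u|c f /= Df u]; first by rewrite coef0 eqxx.
  by rewrite coefD; have [->|/Df//] := eqVneq f`_u 0; rewrite add0r => /Dg.
move=> /sgring_coefM [x [y [-> cx fy]]]; rewrite -[i]add0n.
by apply: ord_ge_add => //; [exact: sgring_supp cx|exact: Df].
Qed.

(** Powers of the maximal ideal are monomial: the support condition cuts out an ideal containing the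
    generating products, and conversely [f] is a sum of monomials whose exponents split into [i]
    positive summands and a rest in [H]. *)
Lemma ideal_exp_supp i f :
  ideal_exp m i f <-> forall u, f`_u != 0 -> ord_ge H i u.
Proof.
split.
  have sub1 : m `<=` Ideal (supp_closed 1).
    apply: ideal_span_min => g [s [Hs s0 hg]] u /=; rewrite hg coefXn.
    by have [-> _|_] := eqVneq u s; [exact: ord_ge1|rewrite eqxx].
  elim: i f => [|i IHi] f; first by move=> _ u; exact: sgring_supp.
  apply: (@ideal_span_min _ _ (Ideal (supp_closed i.+1))).
  move=> _ [x mx [y Iy ->]] u /= /sgring_coefM [v [v' [-> xv yv]]].
  rewrite -[i.+1]add1n; apply: ord_ge_add => //; last exact: IHi yv.
  by apply: sub1 xv.
move=> Df; have -> : f = \sum_(u < size f) mk_sgring (f`_u *: 'X^u).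
  apply: sgring_inj; rewrite sgring_sum -[LHS]coefK poly_def.
  apply: eq_bigr => u _; have [->|fu] := eqVneq f`_u 0.
    by rewrite !scale0r mk_sgringE // => j; rewrite coef0 eqxx.
  by rewrite mk_sgring_monE //; exact: sgring_supp fu.
apply: (big_ind (ideal_exp m i)) => [|x y|u _]; [exact: ideal0|exact: idealD|].
have [->|fu] := eqVneq f`_u 0.
  have -> : mk_sgring (0 *: 'X^u) = 0.
    by apply: sgring_inj; rewrite scale0r mk_sgringE // => j; rewrite coef0 eqxx.
  exact: ideal0.
have {fu}Du := Df _ fu; move: (nat_of_ord u) (f`_u) Du => {}u c Du.
have -> : mk_sgring (c *: 'X^u) = mk_sgring c%:P * mk_sgring ('X^u).
  have Hu := ord_ge_mem monoidH Du.
  apply: sgring_inj; rewrite sgringM mk_sgring_monE // -['X^u]scale1r mk_sgring_monE //.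
  rewrite mk_sgringE ?mul_polyC ?scale1r // => j; rewrite coefC.
  by case: j => [_|j]; rewrite ?eqxx //; case: monoidH.
apply: idealM; elim: i u Du {Df} => [|i IHi] u.
  by move=> _; exact: ideal_exp0.
move=> [x [y [Hx x0 Dy ->]]]; have Hy := ord_ge_mem monoidH Dy.
have -> : mk_sgring 'X^(x + y) = mk_sgring 'X^x * mk_sgring 'X^y.
  have Hxy : H (x + y)%N by case: monoidH => _; apply.
  apply: sgring_inj; rewrite sgringM -['X^(x + y)]scale1r -['X^x]scale1r.
  by rewrite -['X^y]scale1r !mk_sgring_monE // !scale1r exprD.
apply: ideal_expS; last exact: IHi.
apply: ideal_span_incl; exists x; split=> //.
by rewrite -['X^x]scale1r mk_sgring_monE.
Qed.

Lemma ideal_exp_mon i c u : ord_ge H i u -> ideal_exp m i (mk_sgring (c *: 'X^u)).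
Proof.
move=> Du; have Hu := ord_ge_mem monoidH Du; apply/ideal_exp_supp => v.
rewrite mk_sgring_monE // coefZ coefXn.
by have [->|] := eqVneq v u; rewrite ?mulr0 ?eqxx.
Qed.

End SemigroupRingPowers.

(** * The tangent cone *)

Section QuotientMap.
Local Open Scope ring_scope.
Variables (A : comPzRingType) (I : ideal A).

Lemma quo_pi_zmod_morphism : zmod_morphism (@quo_pi A I).
Proof.
move=> x y; apply: (addIr (quo_pi I y)).
by rewrite subrK -quo_piD subrK.
Qed.

Lemma quo_pi_monoid_morphism : monoid_morphism (@quo_pi A I).
Proof. by split=> // x y; exact: quo_piM. Qed.

HB.instance Definition _ := GRing.isZmodMorphism.Build A (quo I) (@quo_pi A I)
  quo_pi_zmod_morphism.
HB.instance Definition _ := GRing.isMonoidMorphism.Build A (quo I) (@quo_pi A I)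
  quo_pi_monoid_morphism.

Lemma quo_pi_eq0 x : quo_pi I x = 0 <-> I x.
Proof. by rewrite -(rmorph0 (quo_pi I)) quo_piP subr0. Qed.

End QuotientMap.

Section TangentCone.
Local Open Scope ring_scope.
Variables (k : fieldType) (H : set nat) (a : nat).
Hypotheses (monoidH : submonoid H) (multH : multiplicity H a).
Local Notation S := (sgring k H).
Local Notation m := (sgring_max k H).
Local Notation G := (graded_sum m).
Local Notation gr := (assoc_graded m).
Local Notation D := (ord_ge H).
Local Notation mk_sgring := (@mk_sgring k H).
Implicit Types (p q : G) (f g : {poly k}).

(** Position ([i], [u]) stands for [t^u] in degree [i]. Only positions with [D i u] occur, and those
    with [D i.+1 u] die in [gr]; what survives is each [u] in [H] placed in degree its order. *)
Definition gcoef p i u : k := ((p : {poly S})`_i : {poly k})`_u.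

Lemma gcoef_supp p i u : gcoef p i u != 0 -> D i u.
Proof.
move: u; apply/(ideal_exp_supp monoidH).
by case: p => p /= /asboolP.
Qed.

Lemma gcoefB p q i u : gcoef (p - q) i u = gcoef p i u - gcoef q i u.
Proof. by rewrite /gcoef coefB sgringB coefB. Qed.

Lemma gcoef1 i u : gcoef 1 i u = ((i == 0%N) && (u == 0%N))%:R.
Proof.
rewrite /gcoef coef1; case: eqP => _ /=; first by rewrite coef1.
by rewrite coef0.
Qed.

Lemma gcoefM p q i u : gcoef (p * q) i u =
  \sum_(j < i.+1) \sum_(v < u.+1) gcoef p j v * gcoef q (i - j) (u - v).
Proof.
rewrite /gcoef coefM sgring_sum coef_sum; apply: eq_bigr => j _.
by rewrite sgringM coefM.
Qed.

Lemma graded_inj p q : (forall i u, gcoef p i u = gcoef q i u) -> p = q.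
Proof.
move=> pq; apply/val_inj/polyP => i; apply: sgring_inj; apply/polyP => u.
exact: pq.
Qed.

Lemma graded_shift_supp p :
  graded_shift m p <-> forall i u, gcoef p i u != 0 -> D i.+1 u.
Proof.
split=> [Ip i u|Dp i]; first by move: u; apply/(ideal_exp_supp monoidH); exact: Ip.
by apply/(ideal_exp_supp monoidH) => u; exact: Dp.
Qed.

Definition mk_graded (P : {poly S}) : G := insubd 0 P.

Lemma mk_gradedE (P : {poly S}) : (forall i, ideal_exp m i P`_i) ->
  mk_graded P = P :> {poly S}.
Proof. by move=> IP; rewrite /mk_graded [LHS]insubdK //; apply/asboolP. Qed.

(** The substitution of [t^a], placed in degree 1, for [X]; through it [X] acts on [gr] as the
    initial form of [t^a]. *)
Definition gpoly f : G := mk_graded (\poly_(i < size f) mk_sgring (f`_i *: 'X^(i * a))).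

Lemma gpolyE f i u : gcoef (gpoly f) i u = if u == (i * a)%N then f`_i else 0.
Proof.
rewrite /gcoef mk_gradedE => [|j]; rewrite coef_poly.
  have [lt_i|ge_i] := ltnP i (size f).
    rewrite mk_sgring_monE ?coefZ ?coefXn //; last exact: ord_ge_mem (ord_ge_mul monoidH multH i).
    by case: eqP; rewrite ?mulr1 ?mulr0.
  by rewrite coef0 nth_default ?if_same.
case: ltnP => _; last exact: ideal0.
by apply: ideal_exp_mon => //; apply: ord_ge_mul.
Qed.

Lemma gpolyM_coef f p i u : gcoef (gpoly f * p) i u =
  \sum_(j < i.+1) (if (j * a <= u)%N then f`_j * gcoef p (i - j) (u - j * a) else 0).
Proof.
rewrite gcoefM; apply: eq_bigr => j _; case: leqP => hj.
  rewrite (bigD1 (inord (j * a))) //= inordK // gpolyE eqxx big1 ?addr0 // => v hv.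
  rewrite gpolyE ifN ?mul0r //; apply: contraNneq hv => ev.
  by apply/eqP/val_inj; rewrite /= inordK.
rewrite big1 // => v _; rewrite gpolyE ifN ?mul0r // neq_ltn.
by rewrite (leq_ltn_trans _ hj) // -ltnS.
Qed.

Lemma gpoly_zmod_morphism : zmod_morphism gpoly.
Proof.
move=> f g; apply: graded_inj => i u; rewrite gcoefB !gpolyE coefB.
by case: eqP; rewrite ?subrr.
Qed.

Lemma gpoly_monoid_morphism : monoid_morphism gpoly.
Proof.
split=> [|f g]; apply: graded_inj => i u.
  rewrite gcoef1 gpolyE coef1; case: i => [|i] /=; first by case: (u == 0)%N.
  by rewrite if_same.
rewrite gpolyM_coef gpolyE coefM.
under [RHS]eq_bigr => j _.
  rewrite gpolyE; over.
have [->|nu] := eqVneq u (i * a)%N.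
  apply: eq_bigr => j _; rewrite leq_mul2r -ltnS ltn_ord orbT.
  by rewrite -mulnBl eqxx.
rewrite big1 // => j _; case: ifP => // ju; rewrite ifN ?mulr0 //.
apply: contraNneq nu => e; rewrite -(subnK ju) e -mulnDl subnK //.
by rewrite -ltnS.
Qed.

Definition gr_poly : {rmorphism {poly k} -> gr} :=
  let s : {rmorphism {poly k} -> G} := HB.pack gpoly
    (GRing.isZmodMorphism.Build _ _ gpoly gpoly_zmod_morphism)
    (GRing.isMonoidMorphism.Build _ _ gpoly gpoly_monoid_morphism) in
  quo_pi (graded_shift m) \o s.

(* The coefficient of ['X^i] is the coefficient of the initial form of
   [t^(w + i * a)], placed in degree [nu + i]. *)
Definition gcoord nu w p : {poly k} :=
  \poly_(i < size (p : {poly S})) gcoef p (nu + i) (w + i * a).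

Lemma gcoordE nu w p i : (gcoord nu w p)`_i = gcoef p (nu + i) (w + i * a).
Proof.
rewrite coef_poly; case: ltnP => // ge_i.
rewrite /gcoef [X in sgring_poly X]nth_default ?coef0 //.
by rewrite (leq_trans ge_i) // leq_addl.
Qed.

(** Computed on a chosen representative; the choice is immaterial once no [t^(w + i * a)] lies in
    the power [nu + i + 1], which is [ord_w] below. *)
Definition gr_coord nu w (x : gr) : {poly k} := gcoord nu w (quo_repr x).

Lemma gcoordB nu w p q : gcoord nu w (p - q) = gcoord nu w p - gcoord nu w q.
Proof. by apply/polyP => i; rewrite coefB !gcoordE gcoefB. Qed.

Section Coordinate.
Variables (nu w : nat).
Hypothesis ord_w : forall i, ~ D (nu + i).+1 (w + i * a).

Lemma gr_coord_pi p : gr_coord nu w (quo_pi (graded_shift m) p) = gcoord nu w p.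
Proof.
apply/eqP; rewrite /gr_coord -subr_eq0 -gcoordB; apply/eqP/polyP => i.
rewrite gcoordE coef0; apply/eqP.
have /quo_piP/graded_shift_supp sub : quo_pi (graded_shift m)
    (quo_repr (quo_pi (graded_shift m) p)) = quo_pi (graded_shift m) p.
  exact: quo_reprK.
by apply: contra_notT (ord_w (i:=i)) => /sub.
Qed.

Lemma gr_coordB x y : gr_coord nu w (x - y) = gr_coord nu w x - gr_coord nu w y.
Proof.
by rewrite -(quo_reprK x) -(quo_reprK y) -rmorphB !gr_coord_pi gcoordB.
Qed.

(** Multiplying by [X^j] moves along the ray of [w]. Terms with [j > i] would come from the exponent
    [w - (j - i) * a], which is not in [H] because [w - a] is not. *)
Lemma gr_coordZ f x : (forall s, H s -> w <> (s + a)%N) ->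
  gr_coord nu w (gr_poly f * x) = f * gr_coord nu w x.
Proof.
move=> min_w; have -> : gr_poly f = quo_pi _ (gpoly f) by [].
rewrite -(quo_reprK x) -rmorphM !gr_coord_pi.
apply/polyP => i; rewrite gcoordE gpolyM_coef coefM.
rewrite -(big_mkord xpredT (fun j => if (j * a <= w + i * a)%N
  then f`_j * gcoef (quo_repr x) (nu + i - j) (w + i * a - j * a) else 0)).
rewrite (big_cat_nat (n := i.+1)) ?ltnS ?leq_addl //= big_mkord.
rewrite [X in _ + X]big1_seq ?addr0.
  apply: eq_bigr => j _; have ji : (j <= i)%N by rewrite -ltnS.
  have ja : (j * a <= i * a)%N by rewrite leq_mul2r ji orbT.
  by rewrite (leq_trans ja (leq_addl _ _)) gcoordE mulnBl !addnBA.
move=> j; rewrite mem_index_iota => /andP [_ /andP [ij _]].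
case: leqP => // jw; apply/eqP; rewrite mulf_eq0; apply/orP; right.
apply/negP => /negP /gcoef_supp /(ord_ge_mem monoidH) Hs.
have Hs' : H (w + i * a - j * a + (j - i.+1) * a)%N.
  have [_ HD] := monoidH; apply: HD => //.
  exact: ord_ge_mem (ord_ge_mul monoidH multH _).
apply: (min_w _ Hs'); rewrite -addnA -mulSnr -subSn // subSS mulnBl.
have ja : (i * a <= j * a)%N by rewrite leq_mul2r (ltnW ij) orbT.
apply: (@addIn (i * a)); rewrite -addnA subnK // subnK //.
Qed.

End Coordinate.

Lemma ord_ray i : ~ D (0 + i).+1 (0 + i * a).
Proof.
rewrite !add0n => /(ord_ge_bound multH); have [_ a0 _] := multH.
by rewrite leq_pmul2r // ltnn.
Qed.

Lemma ray_coord_zmod_morphism : zmod_morphism (gr_coord 0 0).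
Proof. by move=> x y; rewrite gr_coordB //; exact: ord_ray. Qed.

(** The gap [u - i * a] is nonnegative and adds under multiplication, so a product lands on the ray
    of multiples of [a] only if both factors lie on it. *)
Lemma ray_coord_monoid_morphism : monoid_morphism (gr_coord 0 0).
Proof.
have D0 p i u : (u < i * a)%N -> gcoef p i u = 0.
  move=> ui; apply/eqP/negP => /negP /gcoef_supp /(ord_ge_bound multH).
  by rewrite leqNgt ui.
split=> [|x y].
  rewrite -(rmorph1 (quo_pi (graded_shift m))) gr_coord_pi; last exact: ord_ray.
  apply/polyP => i; rewrite gcoordE gcoef1 coef1 !add0n muln_eq0.
  have [_ a0 _] := multH; rewrite (gtn_eqF a0) orbF.
  by case: (i == 0)%N.
rewrite -(quo_reprK x) -(quo_reprK y) -rmorphM !gr_coord_pi; try exact: ord_ray.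
move: (quo_repr x) (quo_repr y) => p q.
apply/polyP => i; rewrite gcoordE gcoefM !add0n coefM.
apply: eq_bigr => j _; rewrite !gcoordE !add0n.
have ji : (j <= i)%N by rewrite -ltnS.
have ja : (j * a < (i * a).+1)%N by rewrite ltnS leq_mul2r ji orbT.
rewrite (bigD1 (inord (j * a))) //= inordK // -mulnBl big1 ?addr0 // => v hv.
have nvj : v != (j * a)%N :> nat.
  by apply: contraNneq hv => e; apply/eqP/val_inj; rewrite /= inordK.
have [vj|vj] := ltnP v (j * a); first by rewrite D0 ?mul0r.
rewrite [X in _ * X]D0 ?mulr0 // mulnBl.
by move: (ltn_ord v) nvj vj; rewrite ltnS; lia.
Qed.

End TangentCone.

(** * Criteria for and against the Cohen-Macaulay property of the tangent cone *)

Section TangentConeCM.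
Local Open Scope ring_scope.
Variables (k : fieldType) (H : set nat) (a W : nat).
Hypotheses (monoidH : submonoid H) (multH : multiplicity H a).
Local Notation S := (sgring k H).
Local Notation m := (sgring_max k H).
Local Notation G := (graded_sum m).
Local Notation gr := (assoc_graded m).
Local Notation D := (ord_ge H).
(** The gap between [s] and [a] times its order is at most [W]. This uniform bound yields nilpotency
    and lets a largest gap be chosen. *)
Hypothesis ord_low :
  forall s, H s -> exists2 i, D i s & (s <= i * a + W)%N.

Let ray : {rmorphism gr -> {poly k}} := HB.pack (gr_coord a 0 0)
  (GRing.isZmodMorphism.Build _ _ (gr_coord a 0 0) (ray_coord_zmod_morphism monoidH multH))
  (GRing.isMonoidMorphism.Build _ _ (gr_coord a 0 0) (ray_coord_monoid_morphism k monoidH multH)).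

Let sigma := gr_poly k monoidH multH.

Lemma ray_pi (p : G) : ray (quo_pi (graded_shift m) p) = gcoord a 0 0 p.
Proof. by apply: gr_coord_pi => //; exact: (ord_ray multH). Qed.

Lemma rayK : cancel sigma ray.
Proof.
move=> f; rewrite -[sigma f]mulr1 [LHS]gr_coordZ //; last by case: multH => _; lia.
  by rewrite [X in _ * X](rmorph1 ray) mulr1.
exact: (ord_ray multH).
Qed.

(* In a power [p ^+ N] of an element of the kernel, the coefficients of ['X^i]
   are supported in degrees at least [i * a + N]. *)
Lemma ray_ker_nilp x : ray x = 0 -> exists N, x ^+ N = 0.
Proof.
rewrite -(quo_reprK x); move: (quo_repr x) => p; rewrite ray_pi => p0.
have gap1 i u : gcoef p i u != 0 -> (i * a < u)%N.
  move=> nz; have := ord_ge_bound multH (gcoef_supp monoidH nz).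
  rewrite leq_eqVlt => /predU1P [e|//]; case/eqP: nz.
  by have := congr1 (fun f : {poly k} => f`_i) p0; rewrite gcoordE !add0n e coef0.
have gapN N i u : gcoef (p ^+ N) i u != 0 -> (i * a + N <= u)%N.
  elim: N i u => [|N IHN] i u nz.
    by rewrite addn0; exact: (ord_ge_bound multH (gcoef_supp monoidH nz)).
  rewrite leqNgt; apply/negP => lt_u; case/eqP: nz; rewrite exprS gcoefM.
  rewrite big1 // => j _; rewrite big1 // => v _; apply/eqP.
  rewrite mulf_eq0 -[_ || _]negbK negb_or; apply/negP => /andP [/gap1 + /IHN].
  move: (ltn_ord j) (ltn_ord v); rewrite mulnBl => ji vu jv.
  have : (j * a <= i * a)%N by rewrite leq_mul2r -ltnS ji orbT.
  by lia.
(* A gap above [W] at position ([i], [u]) forces the order of [u] to exceed [i], so the position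
   vanishes in [gr]. *)
exists W.+1; rewrite -rmorphXn; apply/quo_pi_eq0.
apply/(graded_shift_supp monoidH) => i u nz.
have [j Dj uj] := ord_low (ord_ge_mem monoidH (gcoef_supp monoidH nz)).
have := gapN _ _ _ nz => iu; apply: (ord_ge_leq _ _ Dj) => //.
rewrite ltnNge; apply/negP => ji.
have : (j * a <= i * a)%N by rewrite leq_mul2r ji orbT.
by lia.
Qed.

(** The rays [w j + i * a] cover [H], and along each the order grows by exactly 1 with [i]. Their
    coordinates are thus well defined, linear over [k[X]], and vanish together only at 0. *)
Lemma gr_cohen_macaulay (N : nat) (w nu : nat -> nat) :
    (forall s, H s -> exists2 j, (j < N)%N & exists i, s = (w j + i * a)%N) ->
    (forall j i d, (j < N)%N -> D d (w j + i * a)%N <-> (d <= nu j + i)%N) ->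
    (forall j s, (j < N)%N -> H s -> w j <> (s + a)%N) ->
  cohen_macaulay gr.
Proof.
move=> cov ordw minw.
(* Linearity is required of every [C j], hence the value 0 for [j >= N]. *)
pose C j (x : gr) := if (j < N)%N then gr_coord a (nu j) (w j) x else 0.
have nD j : (j < N)%N -> forall i, ~ D (nu j + i).+1 (w j + i * a).
  by move=> jN i /(ordw j i _ jN); rewrite ltnn.
apply: (@cohen_macaulay_free _ _ ray sigma rayK ray_ker_nilp N C).
- move=> j x y; rewrite /C; case: ltnP => [jN|_]; last by rewrite subrr.
  by rewrite gr_coordB //; exact: nD.
- move=> j f x; rewrite /C; case: ltnP => [jN|_]; last by rewrite mulr0.
  by rewrite gr_coordZ //; [exact: nD|move=> s; exact: minw].
move=> x; rewrite -(quo_reprK x); move: (quo_repr x) => p C0.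
apply/quo_pi_eq0/(graded_shift_supp monoidH) => d u nz.
have Du := gcoef_supp monoidH nz.
have [j jN [i ui]] := cov _ (ord_ge_mem monoidH Du).
move: nz Du; rewrite ui => nz /(ordw j i _ jN); rewrite leq_eqVlt.
case/predU1P => [ed|]; last by move/(ordw j i _ jN).
case/eqP: nz; have := C0 j jN; rewrite /C jN gr_coord_pi //; last exact: nD.
by move/(congr1 (fun f : {poly k} => f`_i)); rewrite gcoordE coef0 ed.
Qed.

Lemma gr_not_cohen_macaulay s0 i0 :
  D i0 s0 -> ~ D i0.+1 s0 -> D i0.+2 (s0 + a)%N -> ~ cohen_macaulay gr.
Proof.
move=> Ds0 nDs0 Dsa0.
pose bad s i := [/\ D i s, ~ D i.+1 s & D i.+2 (s + a)%N].
pose P g := `[< exists s i, bad s i /\ (s = i * a + g)%N >].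
have gapP s i : D i s -> (s = i * a + (s - i * a))%N.
  by move=> /(ord_ge_bound multH) h; rewrite subnKC.
have exP : exists g, P g.
  by exists (s0 - i0 * a)%N; apply/asboolP; exists s0, i0; split=> //; exact: gapP.
have bP g : P g -> (g <= W)%N.
  move=> /asboolP [s [i [[Ds nDs _] es]]].
  have [j Dj sj] := ord_low (ord_ge_mem monoidH Ds).
  have ji : (j * a <= i * a)%N.
    rewrite leq_mul2r leqNgt; apply/orP; right; apply/negP => ij; apply: nDs.
    exact: ord_ge_leq ij Dj.
  by lia.
case: (ex_maxnP exP bP) => g /asboolP [s [i [[Ds nDs Dsa] es]]] max_g.
(* If [s + u] had order exactly [i + j], it would be bad with gap larger by [u - j * a]. Maximality
   leaves [u = j * a] with [j > 0], where [Dsa] already raises the order. *)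
have kill j u : (0 < u)%N -> D j u -> D (i + j).+1 (s + u)%N.
  move=> u0 Dj; have [//|nD] := pselect (D (i + j).+1 (s + u)%N).
  have Dsu : D (i + j) (s + u)%N by exact: ord_ge_add.
  have : P (s + u - (i + j) * a)%N.
    apply/asboolP; exists (s + u)%N, (i + j)%N; split; last exact: gapP.
    split=> //; rewrite addnAC -addSn -addSn; exact: ord_ge_add.
  move/max_g; have := ord_ge_bound multH Dj; rewrite mulnDl => ju gu.
  have {}ju : u = (j * a)%N by lia.
  case: j Dj nD Dsu u0 ju {gu} => [|j] Dj nD Dsu u0 ju; first by rewrite ju in u0.
  rewrite ju mulSn addnA addnS -2!addSn; apply: ord_ge_add => //.
  exact: (ord_ge_mul monoidH multH).
pose P0 : {poly S} := (mk_sgring H 'X^s)%:P * 'X^i.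
have Hs : H s := ord_ge_mem monoidH Ds.
have P0E j : P0`_j = if j == i then mk_sgring H 'X^s else 0.
  by rewrite coefCM coefXn; case: eqP; rewrite ?mulr1 ?mulr0.
have gP0 : mk_graded P0 = P0 :> {poly S}.
  apply: mk_gradedE => j; rewrite P0E; case: eqP => [->|_]; last exact: ideal0.
  by rewrite -['X^s]scale1r; exact: ideal_exp_mon.
have z0 j u : gcoef (mk_graded P0) j u = ((j == i) && (u == s))%:R.
  rewrite /gcoef gP0 P0E; case: eqP => _ /=; last by rewrite coef0.
  by rewrite -['X^s]scale1r mk_sgring_monE // scale1r coefXn.
apply: (@not_cohen_macaulay_socle _ _ ray sigma rayK ray_ker_nilp
  (quo_pi (graded_shift m) (mk_graded P0))).
  apply/eqP => /quo_pi_eq0 /(graded_shift_supp monoidH) /(_ i s).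
  by rewrite z0 !eqxx => /(_ (oner_neq0 _)).
move=> x; rewrite -(quo_reprK x); move: (quo_repr x) => p; rewrite ray_pi.
rewrite gcoordE !add0n ?mul0n => p0; rewrite -rmorphM; apply/quo_pi_eq0.
apply/(graded_shift_supp monoidH) => d v; rewrite gcoefM => nz.
have [j [u [jd uv nzp]]] : exists j u, [/\ d = (i + j)%N, v = (s + u)%N & gcoef p j u != 0].
  apply: contra_neqP nz => nex; rewrite big1 // => j _; rewrite big1 // => u _.
  rewrite z0; have [->|nzp] := eqVneq (gcoef p j u) 0; first by rewrite mul0r.
  case: andP => [[/eqP ei /eqP eu]|_]; last by rewrite mulr0.
  case: nex; exists j, u; split=> //; first by rewrite -ei subnK // -ltnS.
  by rewrite -eu subnK // -ltnS.
rewrite jd uv; apply: kill; last exact: gcoef_supp nzp.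
(* Exponent 0 occurs only in degree 0, where [p0] removes it. *)
have Dj := gcoef_supp monoidH nzp; case: j Dj nzp {jd} => [|j] Dj nzp.
  by rewrite lt0n; apply: contra_neq nzp => ->.
exact: ord_ge_gt0 Dj.
Qed.

End TangentConeCM.

(** * Semigroups with arithmetic pseudo-Frobenius numbers *)

Section Submonoids.
Implicit Types H G : set nat.

Lemma submonoid_smallest G : submonoid (smallest submonoid G).
Proof.
split=> [K [[K0 _] _] //|x y Gx Gy K [KM GK]].
by have [_ KD] := KM; apply: KD; [exact: Gx|exact: Gy].
Qed.

Lemma submonoid_mul H x m : submonoid H -> H x -> H (m * x).
Proof.
move=> [H0 HD] Hx; elim: m => [|m IHm]; first by rewrite mul0n.
by rewrite mulSn; apply: HD.
Qed.

Lemma submonoid_gcd_mod H s a : submonoid H -> 0 < a -> {in s, forall x, H x} ->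
  exists2 u, H u & u = \big[gcdn/0]_(x <- s) x %[mod a].
Proof.
move=> monoidH a0; have [H0 HD] := monoidH; elim: s => [|x s IHs] Hs.
  by exists 0; rewrite ?big_nil.
have [|v Hv ev] := IHs; first by move=> y ys; apply: Hs; rewrite inE ys orbT.
have Hx : H x by apply: Hs; rewrite mem_head.
rewrite big_cons; set d := \big[gcdn/0]_(y <- s) y in ev *.
have [x0|x0] := posnP x; first by exists v; rewrite // x0 gcd0n.
have [p q e _] := egcdnP d x0.
(* Bezout reads [p * x = q * d + gcdn x d]; modulo [a], subtracting [q * d] becomes adding [a.-1]
   copies of [q * v]. *)
exists (p * x + a.-1 * (q * v)); first by apply: HD; rewrite ?mulnA; exact: submonoid_mul.
rewrite e [q * d + _]addnC -addnA -modnDmr.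
suff -> : (q * d + a.-1 * (q * v)) %% a = 0 by rewrite addn0.
rewrite -modnDml -modnMmr -ev modnMmr modnDml -mulSn prednK //.
by rewrite modnMr.
Qed.

End Submonoids.

Section ArithmeticPF.
Variables (H : set nat) (a n alpha l b : nat).
Hypotheses (monoidH : submonoid H) (multH : multiplicity H a).
Hypothesis residueH : forall r, exists2 s, H s & s = r %[mod a].
Hypotheses (n_ge3 : 3 <= n) (l_ge2 : 2 <= l) (a_def : a = l + n.-1).
Hypotheses (alpha_gt0 : 0 < alpha) (b_gt0 : 0 < b) (Hb : H b).
Hypothesis HT : forall t, t < n.-1 -> H (l * b + t * alpha).
Hypothesis genH : forall K, submonoid K -> K a -> K b ->
  (forall t, t < n.-1 -> K (l * b + t * alpha)) -> H `<=` K.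
Hypothesis apery_T :
  forall t s, t < n.-1 -> H s -> l * b + t * alpha <> s + a.
Hypothesis maximal_T : forall t s, t < n.-1 -> H s -> 0 < s ->
  exists2 s', H s' & l * b + t * alpha + s = s' + a.

(** With truncated subtraction, this lists [0, b, ..., l * b] for [j <= l] and then
    [l * b + t * alpha] at [j = l + t]; as [a = l + n.-1], the list is exhausted by [j < a]. *)
Definition apery j := minn j l * b + (j - l) * alpha.

Lemma apery_le j : j <= l -> apery j = j * b.
Proof. by rewrite /apery; nia. Qed.

Lemma apery_ge t : apery (l + t) = l * b + t * alpha.
Proof. by rewrite /apery; nia. Qed.

Let HD x y : H x -> H y -> H (x + y). Proof. by case: monoidH => _; apply. Qed.
Let H0 : H 0. Proof. by case: monoidH. Qed.
Let Ha : H a. Proof. by case: multH. Qed.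
Let a_gt0 : 0 < a. Proof. by case: multH. Qed.
Let HM m x : H x -> H (m * x). Proof. exact: submonoid_mul. Qed.

Lemma apery_mem j : j < a -> H (apery j).
Proof.
move=> ja; have [jl|lj] := leqP j l; first by rewrite apery_le //; exact: HM.
by rewrite -(subnKC (ltnW lj)) apery_ge; apply: HT; lia.
Qed.

(** Strong induction, splitting one generator off [s]. Either the sum is again on the list or it
    lies in [a + H], by [maximal_T] where needed, and [down] passes to a smaller element. *)
Lemma apery_cover s : H s -> exists2 j, j < a & exists i, s = apery j + i * a.
Proof.
have split_gen : forall s, H s -> [\/ s = 0, exists2 s', H s' & s = a + s',
    exists2 s', H s' & s = b + s' |
    exists t, t < n.-1 /\ exists2 s', H s' & s = l * b + t * alpha + s'].
  move=> {}s Hs; pose K := [set s | H s /\ [\/ s = 0, exists2 s', H s' & s = a + s',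
    exists2 s', H s' & s = b + s' |
    exists t, t < n.-1 /\ exists2 s', H s' & s = l * b + t * alpha + s']].
  suff : K s by case.
  apply: genH Hs.
  - split; first by split=> //; constructor 1.
    move=> x y [Hx Kx] [Hy Ky]; split; first exact: HD.
    case: Kx => [->//|[x' Hx' ->]|[x' Hx' ->]|[t [tn [x' Hx' ->]]]].
    + by constructor 2; exists (x' + y); [exact: HD|rewrite addnA].
    + by constructor 3; exists (x' + y); [exact: HD|rewrite addnA].
    + by constructor 4; exists t; split=> //; exists (x' + y); [exact: HD|rewrite addnA].
  - by split=> //; constructor 2; exists 0; rewrite ?addn0.
  - by split=> //; constructor 3; exists 0; rewrite ?addn0.
  - move=> t tn; split; first exact: HT.
    by constructor 4; exists t; split=> //; exists 0; rewrite ?addn0.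
elim/ltn_ind: s => s IHs Hs.
have down s' : s = s' + a -> H s' -> exists2 j, j < a & exists i, s = apery j + i * a.
  move=> es Hs'; have [|j ja [i ei]] := IHs s' _ Hs'; first by lia.
  by exists j => //; exists i.+1; rewrite es ei mulSn; lia.
case: (split_gen _ Hs) => [->|[s' Hs' es]|[s' Hs' es]|[t [tn [s' Hs' es]]]].
- by exists 0 => //; exists 0; rewrite apery_le.
- by apply: (down s') => //; rewrite addnC.
- have [|j ja [[|i] ei]] := IHs s' _ Hs'; first by lia.
    have [jl|lj] := ltnP j l.
      exists j.+1; first by lia.
      by exists 0; rewrite es ei !apery_le ?mulSn; lia.
    have [|s2 Hs2 es2] := maximal_T (t := j - l) _ Hb b_gt0; first by lia.
    apply: (down s2) => //; rewrite -es2 es ei -apery_ge subnKC //; lia.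
  apply: (down (b + apery j + i * a)); first by rewrite es ei mulSn; lia.
  by apply: HD; [apply: HD => //; exact: apery_mem|exact: HM].
have [s0|s0] := posnP s'.
  exists (l + t); first by lia.
  by exists 0; rewrite apery_ge es s0 mul0n.
by have [s2 Hs2 es2] := maximal_T tn Hs' s0; apply: (down s2); rewrite // es.
Qed.

(** Counting: the [a] listed elements meet all [a] residue classes, so none is met twice. *)
Lemma apery_mod_inj i j : i < a -> j < a -> apery i = apery j %[mod a] -> i = j.
Proof.
move=> ia ja; pose f (x : 'I_a) : 'I_a := Ordinal (ltn_pmod (apery x) a_gt0).
have inj_f : injective f.
  apply/injectiveP; rewrite /injectiveb /dinjectiveb.
  apply/card_uniqP; rewrite size_map -cardE.
  apply: eq_card => r; rewrite [RHS]inE; apply/idP; apply/codomP.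
  have [s Hs es] := residueH r; have [j' j'a [d ed]] := apery_cover Hs.
  exists (Ordinal j'a); apply/val_inj; rewrite /= -(modn_small (ltn_ord r)) -es ed.
  by rewrite addnC modnMDl.
move=> e; have /inj_f [] // : f (Ordinal ia) = f (Ordinal ja).
by apply/val_inj.
Qed.

Lemma step_congr : exists2 c, 0 < c & b = alpha + c * a.
Proof.
have ab : b = alpha %[mod a].
  have [s Hs es] := residueH (l.-1 * b + alpha).
  have [j ja [d ed]] := apery_cover Hs.
  have {s Hs es ed} e : apery j = l.-1 * b + alpha %[mod a].
    by rewrite -es ed addnC modnMDl.
  (* For [j < l], adding [b] makes [apery j.+1] congruent to [apery (l + 1)]; for [j > l],
     cancelling [alpha] makes [apery j.-1] congruent to [apery l.-1]. Both are impossible, and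
     [j = l] gives the claim. *)
  have [jl|lj] := ltnP j l.
    have /apery_mod_inj : apery j.+1 = apery (l + 1) %[mod a].
      rewrite apery_ge (apery_le jl) mulSn mul1n.
      rewrite (_ : l * b + alpha = b + (l.-1 * b + alpha)); last by nia.
      by apply/eqP; rewrite eqn_modDl -e apery_le // ltnW.
    by lia.
  move: e; rewrite -(subnKC lj) apery_ge; case ej: (j - l) => [|t].
    rewrite mul0n addn0 -{1}(@prednK l) ?mulSn 1?addnC; last by lia.
    by move/eqP; rewrite eqn_modDl => /eqP.
  rewrite mulSn addnCA [l.-1 * b + _]addnC => /eqP; rewrite eqn_modDl => /eqP e.
  have /apery_mod_inj : apery (l + t) = apery l.-1 %[mod a].
    by rewrite apery_ge apery_le // leq_pred.
  by lia.
(* If [b <= alpha], then [l * b + alpha] is [l * b + b] plus a multiple of [a]; as [l * b + b] lies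
   in [a + H], this contradicts [apery_T]. *)
have [ba|ab'] := leqP b alpha.
  have /eqP := ab; rewrite eq_sym eqn_mod_dvd // => /dvdnP [q eq].
  have [|s' Hs' es'] := maximal_T (t := 0) _ Hb b_gt0; first by lia.
  case: (@apery_T 1 (s' + q * a)); first by lia.
    by apply: HD => //; exact: HM.
  by lia.
have /eqP := ab; rewrite eqn_mod_dvd; last exact: ltnW.
by move=> /dvdnP [q eq]; exists q; lia.
Qed.

Lemma apery_uniq j1 i1 j2 i2 : j1 < a -> j2 < a ->
  apery j1 + i1 * a = apery j2 + i2 * a -> j1 = j2 /\ i1 = i2.
Proof.
move=> j1a j2a e; have j12 : j1 = j2.
  apply: apery_mod_inj => //.
  by rewrite -(modnMDl i1) -[RHS](modnMDl i2) addnC e addnC.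
split=> //; move: e; rewrite j12 => /addnI /eqP.
by rewrite eqn_pmul2r // => /eqP.
Qed.

(** Adding [(l - j) * b] carries the case [j < l] to the element [l * b]. *)
Lemma apery_minimal j s : j < a -> H s -> apery j <> s + a.
Proof.
move=> ja Hs e; have [lj|jl] := leqP l j.
  by apply: (@apery_T (j - l) s) => //; rewrite -?apery_ge ?subnKC //; lia.
apply: (@apery_T 0 (s + (l - j) * b)); first by lia.
  by apply: HD => //; exact: HM.
by move: e; rewrite apery_le; nia.
Qed.

(** The sum of the whole list is a crude uniform bound on the gap, in the form [ord_low] asks
    for. *)
Lemma ord_low_apery s : H s -> exists2 i, ord_ge H i s &
  s <= i * a + \sum_(j < a) apery j.
Proof.
move=> /apery_cover [j ja [i ->]]; exists i.
  rewrite addnC -[i]addn0; apply: ord_ge_add => //; last exact: apery_mem.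
  by rewrite addn0; exact: ord_ge_mul.
by rewrite addnC leq_add2l (bigD1 (Ordinal ja)) //= leq_addr.
Qed.

(** * Orders of the elements of the Apery set *)

Variable c : nat.
Hypotheses (c_gt0 : 0 < c) (b_def : b = alpha + c * a).

(** A candidate for the order, shown to be correct when [l <= c] in [ord_ge_aperyE]. *)
Definition apery_ord j := if j <= l then j else 1.

(** As [b = alpha + c * a], each step [alpha] becomes a step [b] after adding [c * a]. Sums of
    listed elements thereby reduce to adding indices. *)
Lemma apery_shift j : apery j + (j - l) * c * a = j * b.
Proof.
have [jl|lj] := leqP j l; first by rewrite apery_le //; nia.
rewrite -{1}(subnKC (ltnW lj)) apery_ge -mulnA -addnA -mulnDr -b_def.
by rewrite -mulnDl subnKC // ltnW.
Qed.

Lemma apery_ord_add : l <= c -> forall j1 j2, j1 < a -> j2 < a ->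
  exists j3 i, [/\ j3 < a, apery j1 + apery j2 = apery j3 + i * a &
    apery_ord j1 + apery_ord j2 <= apery_ord j3 + i].
Proof.
move=> lc j1 j2 j1a j2a.
have := apery_shift j1; have := apery_shift j2.
have [lt12|ge12] := ltnP (j1 + j2) a.
  (* Comparing the three shifts, the sum exceeds [apery (j1 + j2)] by [q * c * a]; [l <= c] makes
     this outweigh the loss of order past index [l]. *)
  have := apery_shift (j1 + j2); set q := j1 + j2 - l - (j1 - l) - (j2 - l).
  have -> : j1 + j2 - l = q + (j1 - l) + (j2 - l) by rewrite /q; lia.
  rewrite !mulnDl => e3 e2 e1; exists (j1 + j2), (q * c); split=> //; first by lia.
  clear e1 e2 e3; have : q * l <= q * c by rewrite leq_mul2l lc orbT.
  rewrite /apery_ord.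
  case: (leqP j1 l) => h1; case: (leqP j2 l) => h2; case: (leqP (j1 + j2) l) => h3.
  - by lia.
  - have : j1 + j2 = l + q by rewrite /q; lia.
    by clearbody q; nia.
  - by lia.
  - have -> : q = j1 by rewrite /q; lia.
    by nia.
  - by lia.
  - have -> : q = j2 by rewrite /q; lia.
    by nia.
  - by lia.
  - have -> : q = l by rewrite /q; lia.
    by nia.
(* When the indices overflow, [a * b] is traded for [b] further multiples of [a]. The summand [a] in
   [q] avoids truncation and is offset by [b - c * a], which equals [alpha] and is positive. *)
set r := j1 + j2 - a; have := apery_shift r.
have r_def : j1 + j2 = r + a by rewrite subnK.
pose q := a + (r - l) - (j1 - l) - (j2 - l).
have q_def : q + (j1 - l) + (j2 - l) = a + (r - l) by rewrite /q; lia.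
have : c * a < b by lia.
have := congr1 (muln^~ c) q_def; have := congr1 (muln^~ b) r_def.
rewrite /= !mulnDl => eb ec ca e3 e2 e1.
have qc : q <= q * c by rewrite leq_pmulr.
exists r, (q * c + (b - c * a)); split; first by rewrite /r; lia.
  have caa : c * a * a <= b * a by rewrite leq_mul2r (ltnW ca) orbT.
  have := congr1 (muln^~ a) ec; rewrite /= !mulnDl [(b - _) * a]mulnBl => eca.
  move: e1 e2 e3 eb eca caa; clear.
  by lia.
have rl : r < j1 by rewrite /r; lia.
have rl' : r < j2 by rewrite /r; lia.
have : apery_ord j1 + apery_ord j2 <= apery_ord r + q + 1; last by lia.
clear -r_def q_def l_ge2 rl rl' j1a j2a a_def n_ge3; clearbody q r; rewrite /apery_ord.
by case: (leqP j1 l) => h1; case: (leqP j2 l) => h2; case: (leqP r l) => h3; lia.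
Qed.

Lemma ord_ge_apery j : j < a -> ord_ge H (apery_ord j) (apery j).
Proof.
move=> ja; rewrite /apery_ord; case: leqP => [jl|lj].
  rewrite apery_le //; elim: j {ja jl} => [|j IHj] //.
  by rewrite mulSn -add1n; apply: ord_ge_add => //; exact: ord_ge1.
apply: ord_ge1 => //; first exact: apery_mem.
rewrite -(subnKC (ltnW lj)) apery_ge; nia.
Qed.

(** The representation by the list is unique, so it suffices to bound [d] by the weight of some
    representation. Induction on the number of summands does this: weights are superadditive, and at
    least 1 on positive elements. *)
Lemma ord_ge_aperyE : l <= c -> forall j i d, j < a ->
  ord_ge H d (apery j + i * a) <-> d <= apery_ord j + i.
Proof.
move=> lc j i d ja; split; last first.
  move=> /ord_ge_leq; apply=> //; apply: ord_ge_add => //; last exact: ord_ge_mul.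
  exact: ord_ge_apery.
move=> Dd; suff [j' [i' [j'a e le_d]]] : exists j' i', [/\ j' < a,
    apery j + i * a = apery j' + i' * a & d <= apery_ord j' + i'].
  by have [-> ->] := apery_uniq ja j'a e.
elim: d (apery j + i * a) Dd => [|d IHd] s.
  by move=> /apery_cover [j' j'a [i' e]]; exists j', i'.
move=> [x [y [Hx x0 Dy ->]]].
have [j2 [i2 [j2a -> le2]]] := IHd _ Dy; have [j1 j1a [i1 e1]] := apery_cover Hx.
have le1 : 0 < apery_ord j1 + i1.
  rewrite lt0n addn_eq0; apply/negP => /andP [/eqP o1 /eqP i10].
  move: o1; rewrite /apery_ord; case: ifP => // _ j10.
  by move: x0; rewrite e1 i10 j10 apery_le.
have [j3 [i3 [j3a e3 le3]]] := apery_ord_add lc j1a j2a.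
exists j3, (i1 + i2 + i3); split=> //; last by lia.
by rewrite e1 !mulnDl; lia.
Qed.

(** In a splitting of [l * b + alpha] both parts are multiples [j * b] with [j < l], as any other
    part would put the total in [a + H]. Their sum is then another listed element, or lies beyond
    [l * b] and hence in [a + H]. *)
Lemma apery_ord1 : ~ ord_ge H 2 (apery l.+1).
Proof.
have l1 : apery l.+1 = l * b + 1 * alpha by rewrite -addn1 apery_ge.
have nT s : H s -> apery l.+1 <> s + a by rewrite l1; apply: apery_T; lia.
move=> [x [y [Hx x0]]]; rewrite -[X in X y]/(ord_ge H 1) => D1y e.
have Hy := ord_ge_mem monoidH D1y.
have y0 : 0 < y by exact: ord_ge_gt0 D1y.
have pure z z' : H z -> H z' -> 0 < z' -> apery l.+1 = z + z' ->
    exists2 j, j < l & z = j * b.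
  move=> Hz Hz' z'0 ez; have [j ja [[|i] ei]] := apery_cover Hz; last first.
    case: (nT (apery j + i * a + z')); last by rewrite ez ei mulSn; lia.
    by apply: HD => //; apply: HD; [exact: apery_mem|exact: HM].
  have [jl|lj] := ltnP j l; first by exists j; rewrite // ei apery_le ?addn0 // ltnW.
  have [|s' Hs' es'] := maximal_T (t := j - l) _ Hz' z'0; first by lia.
  case: (nT _ Hs'); rewrite -es' ez ei -apery_ge subnKC //; lia.
have [j1 j1l e1] := pure _ _ Hx Hy y0 e.
have [j2 j2l e2] : exists2 j, j < l & y = j * b by apply: (pure y x) => //; rewrite addnC.
have [le12|lt12] := leqP (j1 + j2) l.
  have : apery l.+1 = apery (j1 + j2) %[mod a] by rewrite e e1 e2 (apery_le le12) mulnDl.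
  by move/apery_mod_inj; lia.
have [||s' Hs' es'] := maximal_T (t := 0) (s := (j1 + j2 - l) * b) _ (HM _ Hb).
- by lia.
- by rewrite muln_gt0 subn_gt0 lt12.
by apply: (nT _ Hs'); rewrite e e1 e2 -es'; nia.
Qed.

(** Take the least [i] at which the order of [apery l.+1 + i * a] is at least [i + 2]; it exists
    since [i = c] gives [l.+1 * b], of order at least [l + 1], and it is positive by [apery_ord1].
    The preceding point of the ray is the one sought. *)
Lemma bad_apery : c < l -> exists s i,
  [/\ ord_ge H i s, ~ ord_ge H i.+1 s & ord_ge H i.+2 (s + a)].
Proof.
move=> cl; pose P i := `[< ord_ge H i.+2 (apery l.+1 + i * a) >].
have la : l.+1 < a by lia.
have Pc : P c.
  apply/asboolP; have := apery_shift l.+1; rewrite subSnn mul1n => ->.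
  apply: (@ord_ge_leq _ monoidH _ l.+1); first by lia.
  elim: l.+1 => [|j IHj] //.
  by rewrite mulSn -add1n; apply: ord_ge_add => //; exact: ord_ge1.
have exP : exists i, P i by exists c.
case: (ex_minnP exP) => [[|i] /asboolP Pi min_i].
  by case: apery_ord1; move: Pi; rewrite mul0n addn0.
exists (apery l.+1 + i * a), i.+1; split.
- rewrite -add1n; apply: ord_ge_add => //; last exact: ord_ge_mul.
  by have := ord_ge_apery la; rewrite /apery_ord ltnn.
- by move=> Di; have := min_i i; rewrite ltnn => /(_ (asboolT Di)).
- by move: Pi; rewrite mulSn [a + _]addnC addnA.
Qed.

Lemma arithmetic_PF_cohen_macaulay (k : fieldType) :
  cohen_macaulay (assoc_graded (sgring_max k H)) <-> l <= c.
Proof.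
split=> [CM|lc].
  rewrite leqNgt; apply/negP => /bad_apery [s [i [Ds nDs Dsa]]].
  exact: (gr_not_cohen_macaulay monoidH multH ord_low_apery Ds nDs Dsa CM).
apply: (gr_cohen_macaulay k monoidH multH ord_low_apery (N := a)
  (w := apery) (nu := apery_ord)).
- exact: apery_cover.
- by move=> j i d; exact: ord_ge_aperyE.
- exact: apery_minimal.
Qed.

End ArithmeticPF.

(** * From the hypotheses of the theorem to the arithmetic setting *)

Lemma numerical_semigroup_residue H a r : numerical_semigroup H -> 0 < a ->
  exists2 s, H s & s = r %[mod a].
Proof.
move=> [s [_ gcd_s ->]] a0; have monoidH := submonoid_smallest [set` s].
have [|u Hu eu] := submonoid_gcd_mod (s := s) monoidH a0.
  by move=> x xs K [_ sK]; exact: sK.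
exists (r * u); first exact: (submonoid_mul _ monoidH Hu).
by rewrite -modnMmr eu gcd_s modnMmr muln1.
Qed.

Lemma pseudo_frobeniusP H (z : nat) : pseudo_frobenius H z%:Z%R ->
  ~ H z /\ forall s, H s -> 0 < s -> H (z + s).
Proof.
move=> [nHz Hz]; split=> [Hz'|s Hs s0]; first by apply: nHz; exists z.
by have [s' Hs' [<-]] := Hz s Hs s0.
Qed.

Unset Implicit Arguments.
Set Strict Implicit.
Set Printing Implicit Defensive.

Theorem theorem4p1 (k : fieldType) (H : set nat) (n a h alpha l b : nat)
  (H_semigroup : numerical_semigroup H)
  (H_embdim : embedding_dimension H n) (n_ge3 : 3 <= n)
  (H_mult : multiplicity H a)
  (H_stretched : stretched (quo (sgring_power k H a)))
  (alpha_gt0 : 0 < alpha)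
  (H_PF : pseudo_frobenius H =
            [set (h + i * alpha)%:Z%R | i in [set i | 1 <= i <= n - 1]])
  (l_def : l = a - n + 1) (l_ge2 : 2 <= l)
  (b_def : l * b = h + 1 * alpha + a)
  (H_gens : minimal_generators H
     ([set a; b] `|`
      ([set h + i * alpha + a | i in [set i | 1 <= i <= n - 1]]
         `\ (h + 1 * alpha + a)))) :
  exists h1 : nat,
    h = h1 * a + (l - 1) * b /\
    (cohen_macaulay (assoc_graded (sgring_max k H)) <-> l <= h1 + 1).
Proof.
have [Ha a_gt0 _] := H_mult; have [genE _] := H_gens.
have monoidH : submonoid H by rewrite -genE; exact: submonoid_smallest.
(* [l >= 2] rules out truncation in [a - n]. *)
have a_def : a = l + n.-1 by lia.
have b_gt0 : 0 < b by rewrite lt0n; apply/eqP => b0; rewrite b0 muln0 in b_def; lia.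
have Hb : H b by rewrite -genE => K [_]; apply; left; right.
have PF t : t < n.-1 -> ~ H (h + t.+1 * alpha) /\
    forall s, H s -> 0 < s -> H (h + t.+1 * alpha + s).
  move=> tn; apply: pseudo_frobeniusP; rewrite H_PF.
  by exists t.+1 => //=; lia.
have TE t : l * b + t * alpha = h + t.+1 * alpha + a by rewrite b_def mulSn; lia.
have residueH r := numerical_semigroup_residue r H_semigroup a_gt0.
have HT t : t < n.-1 -> H (l * b + t * alpha).
  by move=> /PF [_]; rewrite TE; apply.
have genH K : submonoid K -> K a -> K b ->
    (forall t, t < n.-1 -> K (l * b + t * alpha)) -> H `<=` K.
  move=> monoidK Ka Kb KT; rewrite -genE; apply: smallest_sub => //.
  move=> _ [[->|->] //|[[[|i] // /andP [_ i_le] <-] _]].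
  by rewrite -TE; apply: KT; lia.
have apery_T t s : t < n.-1 -> H s -> l * b + t * alpha <> s + a.
  by move=> /PF [nH _] Hs; rewrite TE => /addIn e; apply: nH; rewrite e.
have maximal_T t s : t < n.-1 -> H s -> 0 < s ->
    exists2 s', H s' & l * b + t * alpha + s = s' + a.
  move=> /PF [_ Hmax] Hs s0; exists (h + t.+1 * alpha + s); first exact: Hmax.
  by rewrite TE; lia.
have [c c_gt0 bE] := step_congr monoidH H_mult residueH n_ge3 l_ge2 a_def
  alpha_gt0 b_gt0 Hb HT genH apery_T maximal_T.
(* Here [h = l * b - alpha - a] and [b - alpha = c * a], which leaves
   [(l - 1) * b + (c - 1) * a]. *)
exists (c - 1); split; first by rewrite !mulnBl !mul1n; nia.
rewrite subnK //.
exact: (arithmetic_PF_cohen_macaulay monoidH H_mult residueH n_ge3 l_ge2 a_def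
  alpha_gt0 b_gt0 Hb HT genH apery_T maximal_T c_gt0 bE).
Qed.
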